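(* Every positive integer can be written as a sum of at most $22$ dodecahedral numbers. Moreover, $22$ is the smallest positive integer with this property.
   Context: For a positive integer $n$, the $n$-th dodecahedral number is $D_n=\frac{n(3n-1)(3n-2)}{2}$. Repetitions are allowed in sums. *)

(* Defs.v *)
From mathcomp Require Import all_boot.

Set Implicit Arguments.
Unset Strict Implicit.
Unset Printing Implicit Defensive.

(* For 0 < n the truncated subtractions and the division by 2 are exact
   (see [dodecahedral_exact]). *)
Definition dodecahedral (n : nat) : nat :=
  (n * (3 * n - 1) * (3 * n - 2)) %/ 2.

Lemma dodecahedral_exact (n : nat) :
  2 * dodecahedral n = n * (3 * n - 1) * (3 * n - 2).
Proof.
rewrite /dodecahedral mulnC divnK // dvdn2 !oddM.
case: n => [|n] //; rewrite !oddB ?oddM //=; last by rewrite mulnS.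
by case: (odd n).
Qed.

(* [s] lists the indices of the summands; repetitions are allowed. *)
Definition sum_of_at_most_dodecahedral (k N : nat) : Prop :=
  exists s : seq nat,
    [/\ size s <= k, all (fun n => 0 < n) s & N = \sum_(n <- s) dodecahedral n].

Definition every_sum_of_at_most_dodecahedral (k : nat) : Prop :=
  forall N : nat, 0 < N -> sum_of_at_most_dodecahedral k N.

(* Main.v *)
Require Import Defs.
From mathcomp Require Import all_boot all_order all_algebra.
From mathcomp Require Import zify ring.

(** Write D(n) for the n-th dodecahedral number, with D(0) = 0, and S_k for
    the set of sums of at most k of them.

    The value 22 is forced by 79: below it lie only D(1) = 1 and D(2) = 20, and
    the cheapest way to pay 79 with these is 3 * 20 + 19 * 1.

    For the upper bound, the odd part of D around a cancels in a symmetric pair: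
      D(a + x) + D(a - x) = 2 D(a) + 9 (3a - 1) x^2    for x <= a.
    Four such pairs and the four-square theorem of Lagrange put
    8 D(a) + 9 (3a - 1) m into S_8 for every m <= a^2.  Using two consecutive
    centres a and a + 1, eight summands each, gives every number
      8 D(a) + 8 D(a + 1) + 9 ((3a - 1) m1 + (3a + 2) m2)
    with m1 <= a^2 and m2 <= (a + 1)^2.  The moduli 3a - 1 and 3a + 2 are
    coprime, so some m2 < 3a - 1 brings the bracket to any prescribed residue
    mod 3a - 1, and m1 then moves it freely.  The factor 9 costs one more
    summand: D(n) = n mod 9, so a suitable D(r) with r <= 8 corrects the residue
    of N mod 9.  Thus S_17 contains a whole interval of numbers N around each
    a (sum_dodecahedral_window); its length is about 27 a^3, while passing from
    a to a + 1 moves it by about 216 a^2, so from a = 14 on these intervals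
    overlap and cover everything beyond 223223.

    Smaller numbers follow from a finite search below 700 and from the remark
    that a long enough interval inside S_k grows, at the price of one summand,
    to an interval inside S_(k + 1) reaching as far as the gaps of D are no
    longer than the original interval (sum_dodecahedral_ascent). *)

Set Implicit Arguments.
Unset Strict Implicit.
Unset Printing Implicit Defensive.

(** * The four-square theorem *)

Section FourSquares.

Import Order.TTheory GRing.Theory Num.Theory.
Local Open Scope ring_scope.

(** Signed bases, because the descent below needs residues balanced around 0. *)
Definition four_squares (n : int) : Prop :=
  exists a b c d : int, n = a ^+ 2 + b ^+ 2 + c ^+ 2 + d ^+ 2.

Lemma four_squaresM (m n : int) :
  four_squares m -> four_squares n -> four_squares (m * n).
Proof.
move=> [a [b [c [d ->]]]] [x [y [z [t ->]]]].
exists (a * x + b * y + c * z + d * t), (a * y - b * x + c * t - d * z).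
exists (a * z - c * x + d * y - b * t), (a * t - d * x + b * z - c * y).
by ring.
Qed.

(** The half-open choice of the residue matters: in the descent the extreme
    case |y| = m / 2 must come with a known sign. *)
Lemma balanced_residue (m x : int) : 0 < m ->
  exists k y : int, [/\ x = m * k + y, - m < 2 * y & 2 * y <= m].
Proof.
move=> m0; pose k := (x %/ m)%Z; pose y := (x %% m)%Z.
have xE : x = m * k + y by rewrite mulrC -divz_eq.
have y0 : 0 <= y by rewrite modz_ge0 // gt_eqF.
have ym : y < m by rewrite ltz_pmod.
have [le|lt] := leP (2 * y) m.
  by exists k, y; split=> //; lia.
by exists (k + 1), (y - m); split; lia.
Qed.

Lemma half_square_max (m y : int) :
  - m < 2 * y -> 2 * y <= m ->
  4 * y ^+ 2 <= m ^+ 2 /\ (4 * y ^+ 2 = m ^+ 2 -> 2 * y = m).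
Proof. by move=> lo hi; split=> [|e]; nia. Qed.

Lemma sum_quarters (A B C D M : int) :
  4 * A <= M -> 4 * B <= M -> 4 * C <= M -> 4 * D <= M ->
  A + B + C + D <= M /\
  (A + B + C + D = M -> [/\ 4 * A = M, 4 * B = M, 4 * C = M & 4 * D = M]).
Proof. by move=> *; split=> [|?]; [lia | split; lia]. Qed.

(** Fermat's descent on the multiplier m.  With x_i = m k_i + y_i and y_i
    balanced, the sum of the y_i^2 is m r with 0 <= r <= m, and expanding the
    x_i^2 gives p = r + m K + 2 S, where K is the sum of the k_i^2 and S that of
    the k_i y_i.  If r is 0 or m, then m divides p, whence m = 1.  Otherwise
      r p = r^2 + (m r) K + 2 r S = (r + S)^2 + (sum y_i^2 * sum k_i^2 - S^2),
    and the last bracket is a sum of three squares by Euler's identity, so the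
    smaller multiple r p of p is a sum of four squares. *)
Lemma four_squares_descent (p m : nat) : prime p -> (0 < m < p)%N ->
  four_squares (m%:Z * p%:Z) -> four_squares p%:Z.
Proof.
move=> pr; elim/ltn_ind: m => m IH /andP[m0 mp] [x1 [x2 [x3 [x4 sqE]]]].
have m0Z : 0 < m%:Z by lia.
have done1 (q : int) : p%:Z = m%:Z * q -> four_squares p%:Z.
  move=> e; have /(primeP pr).2 : (m %| p)%N by apply/dvdnP; exists `|q|%N; lia.
  case/orP=> /eqP mE; last by rewrite mE ltnn in mp.
  by exists x1, x2, x3, x4; rewrite -sqE mE mul1r.
have [k1 [y1 [e1 lo1 hi1]]] := balanced_residue x1 m0Z.
have [k2 [y2 [e2 lo2 hi2]]] := balanced_residue x2 m0Z.
have [k3 [y3 [e3 lo3 hi3]]] := balanced_residue x3 m0Z.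
have [k4 [y4 [e4 lo4 hi4]]] := balanced_residue x4 m0Z.
have [b1 t1] := half_square_max lo1 hi1.
have [b2 t2] := half_square_max lo2 hi2.
have [b3 t3] := half_square_max lo3 hi3.
have [b4 t4] := half_square_max lo4 hi4.
pose K := k1 ^+ 2 + k2 ^+ 2 + k3 ^+ 2 + k4 ^+ 2.
pose S := k1 * y1 + k2 * y2 + k3 * y3 + k4 * y4.
pose r := p%:Z - m%:Z * K - 2 * S.
have rE : m%:Z * r = y1 ^+ 2 + y2 ^+ 2 + y3 ^+ 2 + y4 ^+ 2.
  by rewrite /r /K /S !mulrBr sqE e1 e2 e3 e4; ring.
have [sum_le sum_eq] := sum_quarters b1 b2 b3 b4.
have r_ge0 : 0 <= r.
  by rewrite -(pmulr_rge0 _ m0Z) rE !addr_ge0 ?sqr_ge0.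
have r_lem : r <= m%:Z.
  by rewrite -(ler_pM2l m0Z) rE -expr2.
have pE : p%:Z = r + m%:Z * K + 2 * S by rewrite /r; ring.
(* r = 0: all the y_i vanish. *)
have [r0|r_neq0] := eqVneq r 0.
  have := rE; rewrite r0 mulr0 => /esym/eqP.
  rewrite !paddr_eq0 ?addr_ge0 ?sqr_ge0 // !sqrf_eq0.
  move=> /andP[/andP[/andP[/eqP z1 /eqP z2] /eqP z3] /eqP z4].
  by apply: (done1 K); rewrite pE r0 /S z1 z2 z3 z4; ring.
(* r = m: every 4 y_i^2 attains its bound m^2, so every y_i is m / 2. *)
have [rm|r_neqm] := eqVneq r m%:Z.
  have [|/t1 z1 /t2 z2 /t3 z3 /t4 z4] := sum_eq.
    by rewrite -rE rm expr2.
  apply: (done1 (1 + K + k1 + k2 + k3 + k4)).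
  have -> : p%:Z = r + m%:Z * K
      + (k1 * (2 * y1) + k2 * (2 * y2) + k3 * (2 * y3) + k4 * (2 * y4)).
    by rewrite pE /S; ring.
  by rewrite z1 z2 z3 z4 rm; ring.
have rn : r = `|r|%N by rewrite gez0_abs.
have r_gt0 : (0 < `|r|)%N by rewrite absz_gt0.
have r_ltm : (`|r| < m)%N by rewrite -ltz_nat -rn lt_neqAle r_neqm.
apply: (IH `|r|%N) => //; first by rewrite r_gt0 (ltn_trans r_ltm).
exists (r + S), (k1 * y2 - k2 * y1 + k3 * y4 - k4 * y3).
exists (k1 * y3 - k3 * y1 + k4 * y2 - k2 * y4).
exists (k1 * y4 - k4 * y1 + k2 * y3 - k3 * y2).
have -> : (`|r|%N)%:Z * p%:Z = r ^+ 2 + (m%:Z * r) * K + 2 * (r * S).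
  by rewrite -rn pE; ring.
by rewrite rE /K /S; ring.
Qed.

End FourSquares.

(** Modulo p = 2h + 1 the h + 1 squares x^2 with x <= h are distinct, and so are
    the h + 1 numbers - 1 - y^2 with y <= h; as there are p + 1 of them in all,
    some x^2 and some - 1 - y^2 agree. *)
Lemma prime_dvdn_sqrDsqrD1 (h : nat) : prime h.*2.+1 ->
  exists x y : nat,
    [/\ x <= h, y <= h & h.*2.+1 %| x ^ 2 + y ^ 2 + 1].
Proof.
move=> pr; set p := h.*2.+1 in pr *.
have sqr_inj (x y : nat) : x <= h -> y <= h -> x ^ 2 = y ^ 2 %[mod p] -> x = y.
  wlog le_xy : x y / x <= y.
    move=> W xh yh e; have [le_xy|/ltnW le_yx] := leqP x y; first exact: W.
    by apply: esym; apply: W.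
  move=> xh yh /esym e; move/eqP: e; rewrite eqn_mod_dvd ?leq_sqr // subn_sqr.
  rewrite Euclid_dvdM // => /orP[/dvdn_leq|/dvdn_leq]; rewrite /p; lia.
pose f (x : 'I_h.+1) : 'I_p := inord (x ^ 2 %% p).
(* rev_ord sends u to p - 1 - u, hence g y stands for - 1 - y^2. *)
pose g (y : 'I_h.+1) : 'I_p := rev_ord (f y).
have f_val x : f x = x ^ 2 %% p :> nat by rewrite inordK // ltn_pmod.
have f_inj : injective f.
  move=> x y /(congr1 val); rewrite /= !f_val => e.
  by apply: val_inj; apply: sqr_inj e; apply: leq_ord.
have g_inj : injective g by move=> x y /rev_ord_inj/f_inj.
have [z] : exists z, (z \in codom f) && (z \in codom g).
  apply/existsP; rewrite -[[exists z, _]]negbK; apply/negP => /existsPn dis.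
  have /eqP := cardUI (mem (codom f)) (mem (codom g)).
  have -> : #|[predI codom f & codom g]| = 0.
    by apply: eq_card0 => z; apply/negbTE/dis.
  rewrite !card_codom // !card_ord addn0 => /eqP cU.
  have := max_card [predU codom f & codom g].
  by rewrite cU card_ord /p; lia.
case/andP=> /codomP[x zx] /codomP[y zy].
exists x, y; split; [exact: leq_ord | exact: leq_ord |].
have := congr1 val (etrans (esym zx) zy); rewrite /= !f_val => e.
have y_lt : y ^ 2 %% p < p by rewrite ltn_pmod.
rewrite /dvdn -modnDml -(modnDm (x ^ 2)) modnDml e.
by rewrite (_ : _ + _ + 1 = p) ?modnn //; lia.
Qed.

Lemma four_squares_prime (p : nat) : prime p -> four_squares p.
Proof.
move=> pr; have [odd_p|/(prime_oddPn pr) pE] := boolP (odd p); last first.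
  by rewrite pE; exists 1, 1, 0, 0.
have pE : p = (p./2).*2.+1 by rewrite -[LHS]odd_double_half odd_p.
have := pr; rewrite {1}pE => /prime_dvdn_sqrDsqrD1[x [y []]].
rewrite -pE => xh yh /dvdnP[m mE].
have p1 := prime_gt1 pr.
apply: (@four_squares_descent p m) => //.
  (* m p = x^2 + y^2 + 1 < p^2 since x and y are below p / 2. *)
  by apply/andP; split; nia.
by exists (Posz x), (Posz y), (Posz 1), (Posz 0); lia.
Qed.

Theorem lagrange_four_squares (n : nat) :
  exists a b c d : nat, n = a ^ 2 + b ^ 2 + c ^ 2 + d ^ 2.
Proof.
suff [a [b [c [d e]]]] : four_squares n.
  have sqE (x : int) : (x ^+ 2)%R = Posz (`|x| ^ 2)%N.
    by rewrite -abszX gez0_abs // Num.Theory.sqr_ge0.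
  by move: e; rewrite !sqE -!PoszD => -[e]; exists `|a|%N, `|b|%N, `|c|%N, `|d|%N.
elim/ltn_ind: n => n IH; have [n1|n1] := leqP n 1.
  by exists (Posz n), (Posz 0), (Posz 0), (Posz 0); nia.
have pn := pdiv_dvd n; have pr := pdiv_prime n1.
rewrite -(divnK pn) PoszM; apply: four_squaresM (four_squares_prime pr).
by apply: IH; rewrite ltn_Pdiv ?prime_gt1 // ltnW.
Qed.

(** * Dodecahedral numbers and their symmetric pairs *)

(** The cubic polynomial behind D, with its negative term moved to the left to
    stay within the natural numbers. *)
Lemma dodecahedralE (n : nat) :
  2 * dodecahedral n + 9 * n ^ 2 = 9 * n ^ 3 + 2 * n.
Proof. by rewrite dodecahedral_exact; case: n => [|n] //; nia. Qed.

Lemma dodecahedralS (n : nat) :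
  2 * dodecahedral n.+1 = 2 * dodecahedral n + 27 * n ^ 2 + 9 * n + 2.
Proof. by have := dodecahedralE n; have := dodecahedralE n.+1; nia. Qed.

Lemma dodecahedral_ge (n : nat) : n <= dodecahedral n.
Proof. by elim: n => // n IH; have := dodecahedralS n; lia. Qed.

Lemma leq_dodecahedral : {homo dodecahedral : m n / m <= n}.
Proof.
by apply: homo_leq leq_trans _ => // n; have := dodecahedralS n; lia.
Qed.

(** From 2 D(n) = 9 n^3 - 9 n^2 + 2 n, as 2 is invertible mod 9. *)
Lemma dodecahedral_modn9 (n : nat) : dodecahedral n = n %[mod 9].
Proof.
have := dodecahedralE n; move: (n ^ 2) (n ^ 3) => s c; lia.
Qed.

(** The odd powers of x cancel, and D has degree 3, so only x^2 survives. *)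
Lemma dodecahedral_pair (a x : nat) : x <= a ->
  dodecahedral (a + x) + dodecahedral (a - x) + 9 * x ^ 2
    = 2 * dodecahedral a + 27 * a * x ^ 2.
Proof.
(* With t = a - x no subtraction is left: the centre is t + x. *)
move=> /subnK; move: (a - x) => t <-.
have := (dodecahedralE t, dodecahedralE (t + x), dodecahedralE (t + x + x)).
move: (dodecahedral _) (dodecahedral _) (dodecahedral _) => u v w.
by rewrite !expnS !expn0 !muln1 => -[[e1 e2] e3]; lia.
Qed.

(** * Closure properties of sums of dodecahedral numbers *)

Lemma sum_dodecahedral0 (k : nat) : sum_of_at_most_dodecahedral k 0.
Proof. by exists [::]; rewrite big_nil. Qed.

Lemma sum_dodecahedral1 (n : nat) :
  sum_of_at_most_dodecahedral 1 (dodecahedral n).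
Proof.
case: n => [|n]; first exact: sum_dodecahedral0.
by exists [:: n.+1]; rewrite big_seq1.
Qed.

Lemma sum_dodecahedral_leq (k l N : nat) : k <= l ->
  sum_of_at_most_dodecahedral k N -> sum_of_at_most_dodecahedral l N.
Proof. by move=> kl [s [sk ? ?]]; exists s; split=> //; apply: leq_trans kl. Qed.

Lemma sum_dodecahedralD (k l M N : nat) :
  sum_of_at_most_dodecahedral k M -> sum_of_at_most_dodecahedral l N ->
  sum_of_at_most_dodecahedral (k + l) (M + N).
Proof.
move=> [s [sk s0 ->]] [t [tl t0 ->]]; exists (s ++ t).
by rewrite size_cat all_cat s0 t0 big_cat leq_add.
Qed.

Lemma sum_dodecahedral_pair (a x : nat) : x <= a ->
  sum_of_at_most_dodecahedral 2
    (2 * dodecahedral a + 9 * (3 * a - 1) * x ^ 2).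
Proof.
move=> xa; have -> : 2 * dodecahedral a + 9 * (3 * a - 1) * x ^ 2
    = dodecahedral (a + x) + dodecahedral (a - x).
  have := dodecahedral_pair xa; case: x xa => [|x] xa; nia.
exact: sum_dodecahedralD (sum_dodecahedral1 _) (sum_dodecahedral1 _).
Qed.

(** The bound on m keeps each square below a^2, so that the four numbers that
    Lagrange's theorem provides are admissible half-widths of pairs. *)
Lemma sum_dodecahedral_four_pairs (a m : nat) : m <= a ^ 2 ->
  sum_of_at_most_dodecahedral 8 (8 * dodecahedral a + 9 * (3 * a - 1) * m).
Proof.
have [x [y [z [t ->]]]] := lagrange_four_squares m => le_a.
have P u : u ^ 2 <= a ^ 2 -> sum_of_at_most_dodecahedral 2
    (2 * dodecahedral a + 9 * (3 * a - 1) * u ^ 2).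
  by rewrite leq_sqr => /sum_dodecahedral_pair.
have Px : x ^ 2 <= a ^ 2 by lia.
have Py : y ^ 2 <= a ^ 2 by lia.
have Pz : z ^ 2 <= a ^ 2 by lia.
have Pt : t ^ 2 <= a ^ 2 by lia.
have := sum_dodecahedralD (sum_dodecahedralD (P _ Px) (P _ Py))
          (sum_dodecahedralD (P _ Pz) (P _ Pt)).
by congr sum_of_at_most_dodecahedral; ring.
Qed.

(** * Large numbers *)

(** The window around a starts here: after removing the two central blocks, at
    most D(8) is spent on the residue mod 9 and at most (3a + 2) (3a - 2) on the
    residue mod 3a - 1. *)
Definition threshold (a : nat) : nat :=
  8 * dodecahedral a + 8 * dodecahedral a.+1 + dodecahedral 8
    + 9 * ((3 * a + 2) * (3 * a - 2)).

(** Consecutive windows overlap: a number below threshold (a + 1) is too small to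
    need a multiplier m1 > a^2 of 9 (3a - 1) on top of the central blocks. *)
Lemma threshold_step (a : nat) : 14 <= a ->
  threshold a.+1 <=
    8 * dodecahedral a + 8 * dodecahedral a.+1 + 9 * ((3 * a - 1) * (a ^ 2).+1).
Proof.
move=> /subnKC <-; move: (a - 14) => b; rewrite /threshold.
have := (dodecahedralS (14 + b), dodecahedralS (14 + b).+1, dodecahedralE 8).
move: (dodecahedral _) (dodecahedral _) (dodecahedral _) (dodecahedral _).
by move=> u v w z [[e1 e2] e3]; nia.
Qed.

Lemma sum_dodecahedral_window (a N : nat) : 14 <= a ->
  threshold a <= N -> N < threshold a.+1 ->
  sum_of_at_most_dodecahedral 17 N.
Proof.
move=> a14 loN hiN.
(* Both central blocks count 8 = - 1 times their centre mod 9, so D(r) must be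
   N + a + (a + 1) mod 9. *)
pose r := (N + 2 * a + 1) %% 9.
have r8 : dodecahedral r <= dodecahedral 8.
  by apply: leq_dodecahedral; rewrite -ltnS ltn_pmod.
pose base := dodecahedral r + 8 * dodecahedral a + 8 * dodecahedral a.+1.
have base_le : base + 9 * ((3 * a + 2) * (3 * a - 2)) <= N.
  by apply: leq_trans loN; rewrite /threshold /base; lia.
have [K KE] : exists K, N = base + 9 * K.
  have dvd9 : 9 %| N - base.
    rewrite -eqn_mod_dvd; last by apply: leq_trans base_le; rewrite leq_addr.
    have := (dodecahedral_modn9 r, dodecahedral_modn9 a, dodecahedral_modn9 a.+1).
    rewrite /base /r; case=> [[]]; lia.
  exists ((N - base) %/ 9); rewrite mulnC divnK // subnKC //.
  by apply: leq_trans base_le; rewrite leq_addr.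
pose c := 3 * a - 1; have cE : c.+1 = 3 * a by rewrite /c; lia.
(* m2 has to satisfy (3a + 2) m2 = K mod c; here 3a + 2 = 3 and the inverse of
   3 is a, because 3a = c + 1. *)
pose m2 := (a * K) %% c.
have m2_lt : m2 < c by rewrite ltn_pmod // /c; lia.
have m2_le : (3 * a + 2) * m2 <= K.
  apply: (@leq_trans ((3 * a + 2) * (3 * a - 2))); last by lia.
  by rewrite leq_mul2l; apply/orP; right; lia.
have [m1 m1E] : exists m1, K = (3 * a + 2) * m2 + c * m1.
  have dvdc : c %| K - (3 * a + 2) * m2.
    rewrite -(@dvdn_addr (c * (K + m2)) c) ?dvdn_mulr //.
    have aK : a * K = a * K %/ c * c + m2 by rewrite -divn_eq.
    apply/dvdnP; exists (3 * (a * K %/ c)).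
    have e1 : 3 * (a * K) = c.+1 * K by rewrite cE mulnA.
    have e2 : (3 * a + 2) * m2 = c.+1 * m2 + 2 * m2 by rewrite cE -mulnDl.
    move: m2_le; rewrite e2; move: (a * K %/ c) aK e1 => q; lia.
  by exists ((K - (3 * a + 2) * m2) %/ c); rewrite [c * _]mulnC divnK // subnKC.
have m1_le : m1 <= a ^ 2.
  have : c * m1 < c * (a ^ 2).+1; last by rewrite ltn_mul2l ltnS => /andP[].
  have : 9 * K < 9 * (c * (a ^ 2).+1); last by lia.
  by have := threshold_step a14; rewrite -/c; move: hiN; rewrite {1}KE /base; lia.
have m2_le2 : m2 <= a.+1 ^ 2.
  apply: leq_trans (ltnW m2_lt) _; rewrite /c; case: (a) => [|b] //; clear; lia.
have := sum_dodecahedralD (sum_dodecahedral1 r)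
  (sum_dodecahedralD (sum_dodecahedral_four_pairs m1_le)
                     (sum_dodecahedral_four_pairs m2_le2)).
congr sum_of_at_most_dodecahedral; rewrite KE m1E /base -/c.
have -> : 3 * a.+1 - 1 = 3 * a + 2 by lia.
by ring.
Qed.

Lemma sum_dodecahedral_large (N : nat) : threshold 14 <= N ->
  sum_of_at_most_dodecahedral 17 N.
Proof.
move=> loN; have unbounded : N < threshold (14 + N).
  by rewrite /threshold; have := dodecahedral_ge (14 + N); lia.
have : forall n, N < threshold (14 + n) -> sum_of_at_most_dodecahedral 17 N.
  elim=> [|n IH] ltN; first by rewrite ltnNge loN in ltN.
  have [leN|/IH //] := leqP (threshold (14 + n)) N.
  by apply: sum_dodecahedral_window leN _; rewrite ?leq_addr // -addnS.
by move/(_ N unbounded).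
Qed.

(** * Small numbers *)

(** Removing a suitable D(i) with i <= n + 1 brings N back into [A, B), because
    the translates of [A, B) by consecutive D(i) overlap: the hypothesis says
    that the largest gap D(n + 1) - D(n) is at most B - A. *)
Lemma sum_dodecahedral_ascent (k A B n : nat) :
  27 * n ^ 2 + 9 * n + 2 <= 2 * (B - A) ->
  (forall N, A <= N < B -> sum_of_at_most_dodecahedral k N) ->
  forall N, A <= N < B + dodecahedral n.+1 ->
  sum_of_at_most_dodecahedral k.+1 N.
Proof.
move=> gap base; have {gap base}: forall i, i <= n.+1 -> forall N,
    A <= N < B + dodecahedral i -> sum_of_at_most_dodecahedral k.+1 N; last first.
  by apply.
elim=> [|i IH] le_in N /andP[AN NB].
  apply: sum_dodecahedral_leq (leqnSn k) (base _ _).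
  by rewrite AN -[B]addn0.
have [ltN|leN] := ltnP N (B + dodecahedral i).
  by apply: IH; rewrite ?AN // ltnW.
have DS := dodecahedralS i.
have i2 : i ^ 2 <= n ^ 2 by rewrite leq_sqr.
rewrite -(@subnK (dodecahedral i.+1) N); last by lia.
rewrite -addn1; apply: sum_dodecahedralD (sum_dodecahedral1 _).
by apply: base; lia.
Qed.

(** Exhaustive search over the multiplicities of the indices in ns; what is left
    of N at the end is paid in ones, that is in copies of D(1). *)
Fixpoint dodecahedral_search (ns : seq nat) (k N : nat) : bool :=
  if ns is n :: ns' then
    has (fun c => dodecahedral_search ns' (k - c) (N - c * dodecahedral n))
        (iota 0 (minn k (N %/ dodecahedral n)).+1)
  else N <= k.

Lemma dodecahedral_searchP (ns : seq nat) (k N : nat) :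
  dodecahedral_search ns k N -> sum_of_at_most_dodecahedral k N.
Proof.
have copies c n :
    sum_of_at_most_dodecahedral c (c * dodecahedral n).
  elim: c => [|c IH]; first exact: sum_dodecahedral0.
  by rewrite mulSn; apply: sum_dodecahedralD (sum_dodecahedral1 n) IH.
elim: ns k N => [|n ns IH] k N.
  move=> /sum_dodecahedral_leq; apply.
  by rewrite -[X in sum_of_at_most_dodecahedral _ X]muln1; apply: (copies N 1).
case/hasP=> c; rewrite mem_iota /= ltnS leq_min => /andP[ck cN] /IH P.
rewrite -(subnKC ck) -(@subnKC (c * dodecahedral n) N).
  exact: sum_dodecahedralD (copies c n) P.
by apply: leq_trans (leq_trunc_div N (dodecahedral n)); rewrite leq_mul2r cN orbT.
Qed.

(** The number 239 needs sixteen summands, hence the change at 240; the bound 700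
    makes the interval [240, 700) long enough to start the ascent. *)
Lemma sum_dodecahedral_table (N : nat) : N < 700 ->
  sum_of_at_most_dodecahedral (if N < 240 then 22 else 14) N.
Proof.
move=> ltN; apply: (@dodecahedral_searchP [:: 5; 4; 3; 2]).
have : all (fun M => dodecahedral_search [:: 5; 4; 3; 2]
    (if M < 240 then 22 else 14) M) (iota 0 700) by vm_compute.
by move/allP; apply; rewrite mem_iota.
Qed.

(** The first three ascents go as far as the length of the previous interval
    permits, the fourth as far as necessary: the upper end moves from 700 to
    1516, 5576, 39796 and 227256, which exceeds threshold 14 = 223224. *)
Lemma sum_dodecahedral_medium (N : nat) : 240 <= N -> N < threshold 14 ->
  sum_of_at_most_dodecahedral 18 N.
Proof.
have S14 M : 240 <= M < 700 -> sum_of_at_most_dodecahedral 14 M.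
  by move=> /andP[lo /sum_dodecahedral_table]; rewrite ltnNge lo.
have g15 : 27 * 5 ^ 2 + 9 * 5 + 2 <= 2 * (700 - 240) by [].
have S15 := sum_dodecahedral_ascent g15 S14.
have E6 := dodecahedralE 6; have E10 := dodecahedralE 10.
have E20 := dodecahedralE 20; have E35 := dodecahedralE 35.
have g16 : 27 * 9 ^ 2 + 9 * 9 + 2 <= 2 * (700 + dodecahedral 6 - 240) by lia.
have S16 := sum_dodecahedral_ascent g16 S15.
have g17 : 27 * 19 ^ 2 + 9 * 19 + 2 <=
  2 * (700 + dodecahedral 6 + dodecahedral 10 - 240) by lia.
have S17 := sum_dodecahedral_ascent g17 S16.
have g18 : 27 * 34 ^ 2 + 9 * 34 + 2 <=
  2 * (700 + dodecahedral 6 + dodecahedral 10 + dodecahedral 20 - 240) by lia.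
move=> lo hi; apply: (sum_dodecahedral_ascent g18 S17); rewrite lo /=.
apply: leq_trans hi _; rewrite /threshold.
have := (dodecahedralE 8, dodecahedralE 14, dodecahedralE 15).
by case=> [[]]; lia.
Qed.

Lemma sum_dodecahedral_22 (N : nat) : sum_of_at_most_dodecahedral 22 N.
Proof.
have [ltN|leN] := ltnP N 240.
  by have := @sum_dodecahedral_table N; rewrite ltN; apply; apply: leq_trans ltN _.
have [/(sum_dodecahedral_medium leN)|/sum_dodecahedral_large] :=
  ltnP N (threshold 14); exact: sum_dodecahedral_leq.
Qed.

(** * The exceptional number 79 *)

Lemma sum_dodecahedral_79 (k : nat) :
  sum_of_at_most_dodecahedral k 79 -> 22 <= k.
Proof.
move=> [s [sk s0 sE]]; apply: leq_trans sk.
(* q counts the summands 20, each of which exceeds 1 by 19: then 79 = size s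
   + 19 q with q <= size s leaves 22 as the smallest size, reached at q = 3. *)
suff [q qs] : exists2 q, q <= size s & 79 = size s + 19 * q by lia.
have le79 : \sum_(n <- s) dodecahedral n <= 79 by rewrite -sE.
rewrite sE; elim: s s0 le79 {sE} => [|n s IH] /= s0 le79.
  by exists 0; rewrite ?big_nil.
move: s0 le79; rewrite big_cons => /andP[n0 s0] le79.
have [q qs ->] := IH s0 (leq_trans (leq_addl _ _) le79).
case: n n0 le79 => [|[|[|n]]] // _ le79.
- by exists q; [lia | rewrite (_ : dodecahedral 1 = 1) //; lia].
- by exists q.+1; [lia | rewrite (_ : dodecahedral 2 = 20) //; lia].
have D3 : 84 <= dodecahedral n.+3 by apply: (@leq_dodecahedral 3).
by have := leq_trans D3 (leq_trans (leq_addr _ _) le79).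
Qed.

Theorem theorem1p8 :
  every_sum_of_at_most_dodecahedral 22 /\
  (forall k : nat, 0 < k -> every_sum_of_at_most_dodecahedral k -> 22 <= k).
Proof.
split=> [N _ | k _ all_k]; first exact: sum_dodecahedral_22.
by apply: sum_dodecahedral_79; apply: all_k.
Qed.
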